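(* Let $R$ be a Noetherian commutative ring with non-zero identity and $I$ an ideal of $R$. Let $M$ be a finitely generated $R$-module and $N$ an $I$-torsion $R$-module. Then $R^iD_I(M,N)=0$ for all $i\geq 0$.
   Context: For $R$-modules $M,N$, the generalized ideal transform is $D_I(M,N)=\varinjlim_n \mathrm{Hom}_R(I^nM,N)$, the transition maps being restriction along $I^{j}M\subseteq I^{i}M$ for $i\le j$. $R^iD_I(M,-)$ denotes the $i$-th right derived functor of the functor $D_I(M,-)$ (so $R^0D_I(M,-)=D_I(M,-)$); it is isomorphic to $\varinjlim_n \mathrm{Ext}^i_R(I^nM,-)$. An $R$-module $N$ is $I$-torsion if $\Gamma_I(N)\cong N$, i.e. $\Gamma_I(N)=N$, where $\Gamma_I(N)=\{x\in N : I^nx=0 \text{ for some } n\geq 1\}$. *)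

(* Defs.v *)
From HB Require Import structures.
From mathcomp Require Import all_boot all_order all_algebra.
From mathcomp Require Import generic_quotient ring_quotient.
From mathcomp Require Import boolp.

Set Implicit Arguments.
Unset Strict Implicit.
Unset Printing Implicit Defensive.

Import GRing.Theory.
Local Open Scope ring_scope.
Local Open Scope quotient_scope.

(* Modules over R are [lmodType R], submodules are [submodClosed M], and ideals
   of R are submodules of the regular module R^o; [idealr] from ring_quotient
   does not fit, because it excludes the unit ideal. *)

Section SubmoduleType.
Variables (R : comNzRingType) (M : lmodType R) (S : submodClosed M).

Record submodule : Type := Submodule { submodule_val : M; _ : submodule_val \in S }.

HB.instance Definition _ := [isSub for submodule_val].
HB.instance Definition _ := [Choice of submodule by <:].
HB.instance Definition _ := [SubChoice_isSubLmodule of submodule by <:].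

End SubmoduleType.

Section Inclusion.
Variables (R : comNzRingType) (M : lmodType R) (S T : submodClosed M).
Hypothesis sST : {subset S <= T}.

Definition incl (x : submodule S) : submodule T := Submodule (sST (valP x)).

Fact incl_is_linear : linear incl.
Proof. by move=> a x y; apply: val_inj. Qed.

HB.instance Definition _ := GRing.isLinear.Build R _ _ _ incl incl_is_linear.

End Inclusion.

Section FullSubmodule.
Variables (R : comNzRingType) (M : lmodType R).

Definition full_submod : {pred M} := predT.

Fact full_submod_closed : submod_closed full_submod.
Proof. by []. Qed.

HB.instance Definition _ :=
  GRing.isSubmodClosed.Build R M full_submod full_submod_closed.

End FullSubmodule.
Arguments full_submod {R} M.

Section SubmoduleProduct.
Variables (R : comNzRingType) (M : lmodType R).
Variables (I : submodClosed R^o) (S : submodClosed M).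

(* I S: the finite sums of products a *: x with a in I and x in S *)
Definition mul_submod : {pred M} := fun x =>
  `[< exists s : seq (R * M),
        all (fun p => (p.1 \in I) && (p.2 \in S)) s
        /\ x = \sum_(p <- s) p.1 *: p.2 >].

Fact mul_submod_closed : submod_closed mul_submod.
Proof.
split=> [|a x y /asboolP[s [sP ->]] /asboolP[t [tP ->]]].
  by apply/asboolP; exists [::]; rewrite big_nil.
apply/asboolP; exists ([seq (a * p.1, p.2) | p <- s] ++ t); split.
  rewrite all_cat tP andbT all_map; apply: sub_all sP => p /= /andP[p1 ->].
  by rewrite andbT; apply: (rpredZ a p1).
rewrite big_cat big_map /= scaler_sumr; congr (_ + _).
by apply: eq_bigr => p _; rewrite scalerA.
Qed.

HB.instance Definition _ :=
  GRing.isSubmodClosed.Build R M mul_submod mul_submod_closed.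

End SubmoduleProduct.

Section Powers.
Variables (R : comNzRingType) (I : submodClosed R^o).

Fixpoint ideal_exp (n : nat) : submodClosed R^o :=
  if n is n'.+1 then mul_submod I (ideal_exp n') else full_submod R^o.

Lemma ideal_expS n : {subset ideal_exp n.+1 <= ideal_exp n}.
Proof.
move=> x /asboolP[s [/allP sP ->]]; rewrite big_seq.
by apply: rpred_sum => p /sP/andP[_ p2]; apply: rpredZ.
Qed.

Lemma ideal_exp_le m n : (m <= n)%N -> {subset ideal_exp n <= ideal_exp m}.
Proof.
move=> /subnK <-; elim: (n - m)%N => [//|k IHk] x xI.
by apply: IHk; apply: ideal_expS.
Qed.

Variable M : lmodType R.

Definition exp_submod (n : nat) : submodClosed M :=
  mul_submod (ideal_exp n) (full_submod M).

Lemma exp_submod_le m n : (m <= n)%N -> {subset exp_submod n <= exp_submod m}.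
Proof.
move=> le_mn x /asboolP[s [sP ->]]; apply/asboolP; exists s; split=> //.
by apply: sub_all sP => p /andP[/(ideal_exp_le le_mn) -> ->].
Qed.

(* Gamma_I(M) *)
Definition torsion_part : M -> Prop := fun x =>
  exists2 n : nat, (1 <= n)%N & forall a, a \in ideal_exp n -> a *: x = 0.

Definition torsion_module : Prop := forall x : M, torsion_part x.

End Powers.

Section Finiteness.
Variable R : comNzRingType.

Definition finitely_generated (M : lmodType R) (S : submodClosed M) : Prop :=
  exists n (e : 'I_n -> M), forall x : M,
    x \in S <-> exists c : 'I_n -> R, x = \sum_i c i *: e i.

Definition fg_module (M : lmodType R) : Prop := finitely_generated (full_submod M).

Definition noetherian : Prop := forall J : submodClosed R^o, finitely_generated J.

End Finiteness.

Section HomModule.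
Variables (R : comNzRingType) (M N : lmodType R).

Definition hom : Type := {linear M -> N}.
Implicit Types f g h : hom.

Lemma homP f g : (forall x, f x = g x) -> f = g.
Proof.
case: f g => f [[fa] [fs]] [g [[ga] [gs]]] /= /funext fg.
case: _ / fg in ga gs *.
by rewrite (Prop_irrelevance fa ga) (Prop_irrelevance fs gs).
Qed.

HB.instance Definition _ := gen_eqMixin hom.
HB.instance Definition _ := gen_choiceMixin hom.

Definition hom0 : hom := \0.
Definition hom_opp f : hom := \- f.
Definition hom_add f g : hom := f \+ g.

Fact hom_addA : associative hom_add.
Proof. by move=> f g h; apply: homP => x /=; rewrite addrA. Qed.
Fact hom_addC : commutative hom_add.
Proof. by move=> f g; apply: homP => x /=; rewrite addrC. Qed.
Fact hom_add0 : left_id hom0 hom_add.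
Proof. by move=> f; apply: homP => x /=; rewrite add0r. Qed.
Fact hom_addN : left_inverse hom0 hom_opp hom_add.
Proof. by move=> f; apply: homP => x /=; rewrite addNr. Qed.

HB.instance Definition _ :=
  GRing.isZmodule.Build hom hom_addA hom_addC hom_add0 hom_addN.

Definition scale_fun (a : R) f : M -> N := fun x => a *: f x.
Fact scale_fun_is_linear a f : linear (scale_fun a f).
Proof.
by move=> b x y; rewrite /scale_fun linearP scalerDr !scalerA mulrC.
Qed.
HB.instance Definition _ a f :=
  GRing.isLinear.Build R M N _ (scale_fun a f) (scale_fun_is_linear a f).
Definition hom_scale a f : hom := scale_fun a f.

Fact hom_scaleA a b f : hom_scale a (hom_scale b f) = hom_scale (a * b) f.
Proof. by apply: homP => x; rewrite /= /scale_fun /= scalerA. Qed.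
Fact hom_scale1 : left_id 1 hom_scale.
Proof. by move=> f; apply: homP => x; rewrite /= /scale_fun scale1r. Qed.
Fact hom_scaleDr : right_distributive hom_scale +%R.
Proof. by move=> a f g; apply: homP => x; rewrite /= /scale_fun scalerDr. Qed.
Fact hom_scaleDl f : {morph hom_scale^~ f : a b / a + b}.
Proof. by move=> a b; apply: homP => x; rewrite /= /scale_fun scalerDl. Qed.

HB.instance Definition _ := GRing.Zmodule_isLmodule.Build R hom
  hom_scaleA hom_scale1 hom_scaleDr hom_scaleDl.

End HomModule.

Section HomFunctoriality.
Variables (R : comNzRingType) (M M' N N' : lmodType R).

Definition precomp (u : {linear M' -> M}) (f : hom M N) : hom M' N := f \o u.
Fact precomp_is_linear u : linear (precomp u).
Proof. by move=> a f g; apply: homP. Qed.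
HB.instance Definition _ u :=
  GRing.isLinear.Build R _ _ _ (precomp u) (precomp_is_linear u).

Definition postcomp (v : {linear N -> N'}) (f : hom M N) : hom M N' := v \o f.
Fact postcomp_is_linear v : linear (postcomp v).
Proof. by move=> a f g; apply: homP => x /=; rewrite linearP. Qed.
HB.instance Definition _ v :=
  GRing.isLinear.Build R _ _ _ (postcomp v) (postcomp_is_linear v).

End HomFunctoriality.

Record direct_system (R : comNzRingType) := DirectSystem {
  ds_obj :> nat -> lmodType R;
  ds_map : forall i j, (i <= j)%N -> {linear ds_obj i -> ds_obj j};
  ds_id : forall i (h : (i <= i)%N) x, ds_map h x = x;
  ds_comp : forall i j k (hij : (i <= j)%N) (hjk : (j <= k)%N) (hik : (i <= k)%N) x,
    ds_map hjk (ds_map hij x) = ds_map hik x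
}.
Arguments ds_map {R} d {i j}.

Section DirectLimit.
Variables (R : comNzRingType) (A : direct_system R).

Definition germ : Type := {i : nat & A i}.
HB.instance Definition _ := Choice.on germ.
Implicit Types u v w : germ.

Definition germ_equiv u v : bool :=
  `[< exists k (hu : (tag u <= k)%N) (hv : (tag v <= k)%N),
        ds_map A hu (tagged u) = ds_map A hv (tagged v) >].

Lemma ds_map_le i j k (hij : (i <= j)%N) (hik : (i <= k)%N) (hjk : (j <= k)%N) x y :
  ds_map A hij x = y -> ds_map A hik x = ds_map A hjk y.
Proof. by move=> <-; rewrite (ds_comp hij hjk hik). Qed.

Fact germ_equiv_is_equiv : equiv_class_of germ_equiv.
Proof.
split=> [u|u v|v u w].
- by apply/asboolP; exists (tag u), (leqnn _), (leqnn _).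
- by apply: asbool_equiv_eq; split=> -[k [hu [hv e]]]; exists k, hv, hu.
move=> /asboolP[k [hu [hv e]]] /asboolP[l [hv' [hw e']]]; apply/asboolP.
have hk := leq_maxl k l; have hl := leq_maxr k l.
exists (maxn k l), (leq_trans hu hk), (leq_trans hw hl).
rewrite -(ds_comp hu hk) e (ds_comp _ _ (leq_trans hv hk)).
by rewrite -(ds_comp hw hl) -e' (ds_comp _ _ (leq_trans hv hk)).
Qed.

Canonical germ_equiv_equiv := EquivRelPack germ_equiv_is_equiv.
Canonical germ_equiv_enc := defaultEncModRel germ_equiv.

Definition dirlim : Type := {eq_quot germ_equiv}.
HB.instance Definition _ : EqQuotient germ germ_equiv dirlim := EqQuotient.on dirlim.
HB.instance Definition _ := Choice.on dirlim.

Definition to_dirlim i (x : A i) : dirlim := \pi_dirlim (Tagged (ds_obj A) x).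

Lemma to_dirlim_eq i j (x : A i) (y : A j) :
  to_dirlim x = to_dirlim y <->
  exists k (hi : (i <= k)%N) (hj : (j <= k)%N), ds_map A hi x = ds_map A hj y.
Proof.
split=> [/eqP|h]; first by rewrite /to_dirlim piE => /asboolP.
by apply/eqP; rewrite /to_dirlim piE; apply/asboolP.
Qed.

Lemma to_dirlim_map i j (h : (i <= j)%N) (x : A i) :
  to_dirlim (ds_map A h x) = to_dirlim x.
Proof.
by apply/to_dirlim_eq; exists j, (leqnn j), h; rewrite ds_id.
Qed.

Lemma dirlim_ind (P : dirlim -> Prop) :
  (forall i (x : A i), P (to_dirlim x)) -> forall z, P z.
Proof. by move=> h; elim/quotW => -[i x]; apply: h. Qed.

Lemma dirlim_ind2 (P : dirlim -> dirlim -> Prop) :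
  (forall i (x y : A i), P (to_dirlim x) (to_dirlim y)) -> forall z t, P z t.
Proof.
move=> h; elim/dirlim_ind=> i x; elim/dirlim_ind=> j y.
rewrite -(to_dirlim_map (leq_maxl i j) x) -(to_dirlim_map (leq_maxr i j) y).
exact: h.
Qed.

Lemma dirlim_ind3 (P : dirlim -> dirlim -> dirlim -> Prop) :
  (forall i (x y z : A i), P (to_dirlim x) (to_dirlim y) (to_dirlim z)) ->
  forall s t r, P s t r.
Proof.
move=> h s t r; elim/dirlim_ind: r => k z; elim/dirlim_ind: s => i x.
elim/dirlim_ind: t => j y; set l := maxn i (maxn j k).
have hi : (i <= l)%N by rewrite /l !leq_max leqnn.
have hj : (j <= l)%N by rewrite /l !leq_max leqnn orbT.
have hk : (k <= l)%N by rewrite /l !leq_max leqnn !orbT.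
rewrite -(to_dirlim_map hi x) -(to_dirlim_map hj y) -(to_dirlim_map hk z).
exact: h.
Qed.

Definition germ_add u v : germ :=
  Tagged (ds_obj A) (ds_map A (leq_maxl (tag u) (tag v)) (tagged u) +
            ds_map A (leq_maxr (tag u) (tag v)) (tagged v)).

Definition dirlim0 : dirlim := to_dirlim (0 : A 0%N).
Definition dirlim_add (z t : dirlim) : dirlim := \pi_dirlim (germ_add (repr z) (repr t)).
Definition dirlim_opp (z : dirlim) : dirlim := to_dirlim (- tagged (repr z)).
Definition dirlim_scale (a : R) (z : dirlim) : dirlim := to_dirlim (a *: tagged (repr z)).

Lemma to_dirlim_repr i (x : A i) : exists k (h : (tag (repr (to_dirlim x)) <= k)%N)
  (hi : (i <= k)%N), ds_map A h (tagged (repr (to_dirlim x))) = ds_map A hi x.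
Proof.
apply/to_dirlim_eq; rewrite -[RHS](reprK (to_dirlim x)) /to_dirlim.
by case: (repr _).
Qed.

Lemma to_dirlimD i (x y : A i) :
  dirlim_add (to_dirlim x) (to_dirlim y) = to_dirlim (x + y).
Proof.
have [k [hx [hi ex]]] := to_dirlim_repr x; have [l [hy [hj ey]]] := to_dirlim_repr y.
rewrite /dirlim_add; set u := repr _ in hx ex *; set v := repr _ in hy ey *.
apply/to_dirlim_eq; set m := maxn _ _.
set n := maxn m (maxn k l).
have hm : (m <= n)%N by apply: leq_maxl.
have hk : (k <= n)%N by rewrite /n !leq_max leqnn orbT.
have hl : (l <= n)%N by rewrite /n !leq_max leqnn !orbT.
exists n, hm, (leq_trans hi hk); rewrite !linearD /=.
rewrite (ds_comp _ _ (leq_trans hx hk)) (ds_comp _ _ (leq_trans hy hl)).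
rewrite -(ds_comp hx hk) -(ds_comp hy hl) ex ey.
by rewrite !(ds_comp _ _ (leq_trans hi hk)).
Qed.

Lemma to_dirlimN i (x : A i) : dirlim_opp (to_dirlim x) = to_dirlim (- x).
Proof.
have [k [hx [hi ex]]] := to_dirlim_repr x.
by apply/to_dirlim_eq; exists k, hx, hi; rewrite !linearN ex.
Qed.

Lemma to_dirlimZ a i (x : A i) : dirlim_scale a (to_dirlim x) = to_dirlim (a *: x).
Proof.
have [k [hx [hi ex]]] := to_dirlim_repr x.
by apply/to_dirlim_eq; exists k, hx, hi; rewrite !linearZZ ex.
Qed.

Lemma to_dirlim0 i : to_dirlim (0 : A i) = dirlim0.
Proof. by apply/to_dirlim_eq; exists i, (leqnn i), (leq0n i); rewrite !linear0. Qed.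

Fact dirlim_addA : associative dirlim_add.
Proof. by apply: dirlim_ind3 => i x y z; rewrite !to_dirlimD addrA. Qed.
Fact dirlim_addC : commutative dirlim_add.
Proof. by apply: dirlim_ind2 => i x y; rewrite !to_dirlimD addrC. Qed.
Fact dirlim_add0 : left_id dirlim0 dirlim_add.
Proof. by elim/dirlim_ind=> i x; rewrite -(to_dirlim0 i) to_dirlimD add0r. Qed.
Fact dirlim_addN : left_inverse dirlim0 dirlim_opp dirlim_add.
Proof.
by elim/dirlim_ind=> i x; rewrite to_dirlimN to_dirlimD addNr to_dirlim0.
Qed.

HB.instance Definition _ :=
  GRing.isZmodule.Build dirlim dirlim_addA dirlim_addC dirlim_add0 dirlim_addN.

Lemma to_dirlim_add i (x y : A i) : to_dirlim (x + y) = to_dirlim x + to_dirlim y.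
Proof. by rewrite [RHS]to_dirlimD. Qed.

Fact dirlim_scaleA a b z : dirlim_scale a (dirlim_scale b z) = dirlim_scale (a * b) z.
Proof. by elim/dirlim_ind: z => i x; rewrite !to_dirlimZ scalerA. Qed.
Fact dirlim_scale1 : left_id 1 dirlim_scale.
Proof. by elim/dirlim_ind=> i x; rewrite to_dirlimZ scale1r. Qed.
Fact dirlim_scaleDr : right_distributive dirlim_scale +%R.
Proof.
move=> a; apply: dirlim_ind2 => i x y.
by rewrite -to_dirlim_add !to_dirlimZ -to_dirlim_add scalerDr.
Qed.
Fact dirlim_scaleDl z : {morph dirlim_scale^~ z : a b / a + b}.
Proof.
by move=> a b; elim/dirlim_ind: z => i x; rewrite !to_dirlimZ -to_dirlim_add scalerDl.
Qed.

HB.instance Definition _ := GRing.Zmodule_isLmodule.Build R dirlim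
  dirlim_scaleA dirlim_scale1 dirlim_scaleDr dirlim_scaleDl.

Fact to_dirlim_is_linear i : linear (@to_dirlim i).
Proof. by move=> a x y; rewrite to_dirlim_add -to_dirlimZ. Qed.
HB.instance Definition _ i :=
  GRing.isLinear.Build R _ _ _ (@to_dirlim i) (@to_dirlim_is_linear i).

End DirectLimit.

Record ds_morphism (R : comNzRingType) (A B : direct_system R) := DsMorphism {
  dsm_map :> forall i, {linear A i -> B i};
  dsm_comm : forall i j (h : (i <= j)%N) x,
    dsm_map j (ds_map A h x) = ds_map B h (dsm_map i x)
}.

Section DirectLimitMap.
Variables (R : comNzRingType) (A B : direct_system R) (phi : ds_morphism A B).

Definition dirlim_map (z : dirlim A) : dirlim B := to_dirlim (phi _ (tagged (repr z))).

Lemma dirlim_mapE i (x : A i) : dirlim_map (to_dirlim x) = to_dirlim (phi i x).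
Proof.
have [k [hx [hi ex]]] := to_dirlim_repr x.
by apply/to_dirlim_eq; exists k, hx, hi; rewrite -!dsm_comm ex.
Qed.

Fact dirlim_map_is_linear : linear dirlim_map.
Proof.
move=> a; apply: dirlim_ind2 => i x y.
by rewrite -linearP !dirlim_mapE -linearP linearP.
Qed.
HB.instance Definition _ :=
  GRing.isLinear.Build R _ _ _ dirlim_map dirlim_map_is_linear.

End DirectLimitMap.

Record additive_functor (R : comNzRingType) := AdditiveFunctor {
  fobj :> lmodType R -> lmodType R;
  fmap : forall A B : lmodType R, hom A B -> hom (fobj A) (fobj B);
  fmap_id : forall A x, fmap (idfun : hom A A) x = x;
  fmap_comp : forall A B C (g : hom B C) (f : hom A B) x,
    fmap (g \o f : hom A C) x = fmap g (fmap f x);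
  fmap_add : forall A B (f g : hom A B), fmap (f + g) = fmap f + fmap g
}.
Arguments fmap {R} F {A B} : rename.

Section IdealTransform.
Variables (R : comNzRingType) (I : submodClosed R^o) (M : lmodType R).

Section Object.
Variable N : lmodType R.

Definition transform_obj (n : nat) : lmodType R := hom (submodule (exp_submod I M n)) N.

Definition transform_map m n (h : (m <= n)%N) : {linear transform_obj m -> transform_obj n} :=
  precomp (incl (@exp_submod_le R I M m n h)).

Fact transform_id n (h : (n <= n)%N) f : transform_map h f = f.
Proof. by apply: homP => x /=; congr (f _); apply: val_inj. Qed.

Fact transform_comp i j k (hij : (i <= j)%N) (hjk : (j <= k)%N) (hik : (i <= k)%N) f :
  transform_map hjk (transform_map hij f) = transform_map hik f.
Proof. by apply: homP => x /=; congr (f _); apply: val_inj. Qed.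

Definition transform_system : direct_system R := DirectSystem transform_id transform_comp.

End Object.

Section Morphism.
Variables (N N' : lmodType R) (v : hom N N').

Definition transform_post (n : nat) : {linear transform_system N n -> transform_system N' n} :=
  postcomp v.

Fact transform_post_comm i j (h : (i <= j)%N) x :
  transform_post j (ds_map (transform_system N) h x) =
  ds_map (transform_system N') h (transform_post i x).
Proof. exact: homP. Qed.

Definition transform_fmap : hom (dirlim (transform_system N)) (dirlim (transform_system N')) :=
  dirlim_map (DsMorphism transform_post_comm).

End Morphism.

Fact transform_fmap_id N x : transform_fmap (idfun : hom N N) x = x.
Proof.
by elim/dirlim_ind: x => i f; rewrite [LHS]dirlim_mapE; congr to_dirlim; apply: homP.
Qed.

Fact transform_fmap_comp A B C (g : hom B C) (f : hom A B) x :
  transform_fmap (g \o f : hom A C) x = transform_fmap g (transform_fmap f x).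
Proof.
elim/dirlim_ind: x => i h; rewrite /transform_fmap /= !dirlim_mapE.
by congr to_dirlim; apply: homP.
Qed.

Fact transform_fmap_add A B (f g : hom A B) :
  transform_fmap (f + g) = transform_fmap f + transform_fmap g.
Proof.
apply: homP; elim/dirlim_ind=> i h; rewrite /= !dirlim_mapE -linearD.
by congr to_dirlim; apply: homP.
Qed.

(* D_I(M, -); the system starts at I^0 M = M, which does not affect the limit. *)
Definition ideal_transform : additive_functor R :=
  AdditiveFunctor transform_fmap_id transform_fmap_comp transform_fmap_add.

End IdealTransform.

Section QuotientModule.
Variables (R : comNzRingType) (V : lmodType R) (S : submodClosed V).

Definition zmod_pred : {pred V} := S.
Fact zmod_pred_closed : zmod_closed zmod_pred.
Proof. exact: submodClosedP. Qed.
HB.instance Definition _ := GRing.isZmodClosed.Build V zmod_pred zmod_pred_closed.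

Definition quot_module : Type := Quotient.quot zmod_pred.
HB.instance Definition _ := GRing.Zmodule.on quot_module.

Definition to_quot (x : V) : quot_module := \pi_(Quotient.quot zmod_pred) x.

Lemma to_quot_eq x y : to_quot x = to_quot y <-> x - y \in S.
Proof.
by rewrite (rwP eqP) -(Quotient.idealrBE zmod_pred).
Qed.

Lemma to_quotD x y : to_quot (x + y) = to_quot x + to_quot y.
Proof. exact: Quotient.pi_add. Qed.

Definition quot_scale (a : R) (q : quot_module) : quot_module :=
  to_quot (a *: repr (q : Quotient.quot zmod_pred)).

Lemma to_quotZ a x : quot_scale a (to_quot x) = to_quot (a *: x).
Proof.
apply/to_quot_eq; rewrite -scalerBr; apply/rpredZ/to_quot_eq.
exact: reprK.
Qed.

Lemma quot_ind (P : quot_module -> Prop) : (forall x, P (to_quot x)) -> forall q, P q.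
Proof. by move=> h q; rewrite -[q](@reprK _ (Quotient.quot zmod_pred)). Qed.

Fact quot_scaleA a b q : quot_scale a (quot_scale b q) = quot_scale (a * b) q.
Proof. by elim/quot_ind: q => x; rewrite !to_quotZ scalerA. Qed.
Fact quot_scale1 : left_id 1 quot_scale.
Proof. by elim/quot_ind=> x; rewrite to_quotZ scale1r. Qed.
Fact quot_scaleDr : right_distributive quot_scale +%R.
Proof.
move=> a; elim/quot_ind=> x; elim/quot_ind=> y.
by rewrite -to_quotD !to_quotZ -to_quotD scalerDr.
Qed.
Fact quot_scaleDl q : {morph quot_scale^~ q : a b / a + b}.
Proof. by move=> a b; elim/quot_ind: q => x; rewrite !to_quotZ -to_quotD scalerDl. Qed.

HB.instance Definition _ := GRing.Zmodule_isLmodule.Build R quot_module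
  quot_scaleA quot_scale1 quot_scaleDr quot_scaleDl.

End QuotientModule.

Definition injective_module (R : comNzRingType) (E : lmodType R) : Prop :=
  forall (A B : lmodType R) (i : {linear A -> B}) (f : {linear A -> E}),
    injective i -> exists g : {linear B -> E}, forall x, g (i x) = f x.

Record injective_resolution (R : comNzRingType) (N : lmodType R) := InjectiveResolution {
  res_obj : nat -> lmodType R;
  res_aug : hom N (res_obj 0);
  res_d : forall n, hom (res_obj n) (res_obj n.+1);
  res_injective : forall n, injective_module (res_obj n);
  res_aug_inj : injective res_aug;
  res_exact0 : forall x, res_d 0 x = 0 <-> exists y, res_aug y = x;
  res_exact : forall n x, res_d n.+1 x = 0 <-> exists y, res_d n y = x
}.

Section RightDerived.
Variables (R : comNzRingType) (F : additive_functor R) (N : lmodType R).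
Variable (E : injective_resolution N).

Definition cplx (n : nat) : lmodType R := F (res_obj E n).
Definition cplx_d (n : nat) : hom (cplx n) (cplx n.+1) := fmap F (res_d E n).

Definition cocycle (n : nat) : {pred cplx n} := fun x => cplx_d n x == 0.
Arguments cocycle : clear implicits.

Fact cocycle_closed n : submod_closed (cocycle n).
Proof.
split=> [|a x y /eqP dx /eqP dy]; apply/eqP; first exact: linear0.
by rewrite linearP dx dy scaler0 addr0.
Qed.
HB.instance Definition _ n :=
  GRing.isSubmodClosed.Build R (cplx n) (cocycle n) (cocycle_closed n).

(* the complex is extended by 0 in degree -1 *)
Definition is_coboundary (n : nat) : cplx n -> Prop :=
  if n is n'.+1 then fun x => exists y, cplx_d n' y = x else fun x => x = 0.

Definition coboundary (n : nat) : {pred submodule (cocycle n)} :=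
  fun x => `[< is_coboundary (val x) >].
Arguments coboundary : clear implicits.

Fact coboundary_closed n : submod_closed (coboundary n).
Proof.
split=> [|a x y /asboolP dx /asboolP dy]; apply/asboolP.
  by case: n => [//|n]; exists 0; rewrite linear0.
case: n => [|n] in x y dx dy *; first by rewrite /= dx dy scaler0 addr0.
by case: dx dy => [x' ex] [y' ey]; exists (a *: x' + y'); rewrite linearP ex ey.
Qed.
HB.instance Definition _ n := GRing.isSubmodClosed.Build R (submodule (cocycle n))
  (coboundary n) (coboundary_closed n).

(* R^n F(N) computed with the resolution E: H^n(F(E)), where E is deleted, i.e.
   does not include the augmentation N -> E^0. *)
Definition right_derived (n : nat) : lmodType R := quot_module (coboundary n).

End RightDerived.

(* Main.v *)
(** Write E for the injective resolution of the I-torsion module N.  A class of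
degree i >= 1 is a linear map f : L -> E^i with L = I^n M finitely generated and
d f = 0; it must be shown that f lifts along d : E^(i-1) -> E^i after restriction
to some I^k L (for i = 0, that f vanishes there, which holds because f maps L to
N).  Take a free cover F -> L with kernel K and lift f to h : F -> E^(i-1).  Then
h maps K to the cocycles of E^(i-1), so by induction h lifts through E^(i-2) on
some I^c K.  By Artin-Rees I^k F meets K inside I^c K, and by injectivity of
E^(i-2) the lift u extends to I^k F.  Now h - d u vanishes on I^k F \cap K, and
therefore factors through I^k L as the required lift of f. *)

Require Import Defs.
From mathcomp Require Import all_boot all_order all_algebra.
From HB Require Import structures.
From mathcomp Require Import boolp.

Set Implicit Arguments.
Unset Strict Implicit.
Unset Printing Implicit Defensive.

Import GRing.Theory.
Local Open Scope ring_scope.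

(** * Submodules and factorization of linear maps *)

Section Modules.
Variable R : comNzRingType.

Lemma submod_of_prop (V : lmodType R) (P : V -> Prop) :
    P 0 -> (forall a x y, P x -> P y -> P (a *: x + y)) ->
  exists S : submodClosed V, forall x, x \in S <-> P x.
Proof.
move=> P0 PL; pose p : {pred V} := fun x => `[< P x >].
have pcl : submod_closed p.
  by split=> [|a x y /asboolP Px /asboolP Py]; apply/asboolP; [|apply: PL].
pose m := GRing.isSubmodClosed.Build R V p pcl.
pose S : submodClosed V := HB.pack p m.
by exists S => x; split=> [/asboolP|/asboolP].
Qed.

Lemma submodB (V : lmodType R) (S : submodClosed V) x y :
  x \in S -> y \in S -> x - y \in S.
Proof. by move=> Sx Sy; rewrite -scaleN1r rpredD ?rpredZ. Qed.

Lemma to_quot_eq0 (V : lmodType R) (S : submodClosed V) x : x \in S -> to_quot S x = 0.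
Proof.
have <- : to_quot S 0 = 0 by apply: (addrI (to_quot S 0)); rewrite -to_quotD !addr0.
by move=> Sx; apply/to_quot_eq; rewrite subr0.
Qed.

Lemma linear_of (U V : lmodType R) (f : U -> V) :
  linear f -> exists g : {linear U -> V}, g =1 f.
Proof.
move=> lf; pose m := GRing.isLinear.Build R U V _ f lf.
by pose g : {linear U -> V} := HB.pack f m; exists g.
Qed.

Lemma submodule_val_is_linear (V : lmodType R) (S : submodClosed V) :
  linear (val : submodule S -> V).
Proof. by []. Qed.

Lemma kernel_submod (U V : lmodType R) (f : {linear U -> V}) :
  exists S : submodClosed U, forall x, x \in S <-> f x = 0.
Proof.
apply: submod_of_prop => [|a x y fx fy]; first exact: linear0.
by rewrite linearP fx fy scaler0 addr0.
Qed.

(** [h] composed with a chosen section of [p] is linear, because two choices differ by an element of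
    the kernel of [p], where [h] vanishes. *)
Lemma surj_factor (A B C : lmodType R) (p : {linear A -> B}) (h : {linear A -> C}) :
    (forall y, exists x, p x = y) -> (forall x, p x = 0 -> h x = 0) ->
  exists g : {linear B -> C}, forall x, g (p x) = h x.
Proof.
move=> /choice[s ps] kerh.
have gp x : h (s (p x)) = h x.
  by apply/eqP; rewrite -subr_eq0 -linearB kerh // linearB /= ps subrr.
have [|g gE] := @linear_of B C (h \o s); last by exists g => x; rewrite gE /= gp.
by move=> a x y; rewrite -[in LHS](ps x) -[in LHS](ps y) -linearP /= gp linearP.
Qed.

Lemma generator_in (V : lmodType R) (S : submodClosed V) n (e : 'I_n -> V) :
    (forall x, x \in S <-> exists c : 'I_n -> R, x = \sum_i c i *: e i) ->
  forall j, e j \in S.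
Proof.
move=> eE j; apply/eE; exists (fun k => (k == j)%:R).
by rewrite (bigD1 j) //= eqxx scale1r big1 ?addr0 // => k /negPf->; rewrite scale0r.
Qed.

Lemma row_comb_linear (V : lmodType R) n (e : 'I_n -> V) :
  exists h : {linear 'rV[R]_n -> V}, forall x, h x = \sum_i x 0 i *: e i.
Proof.
apply: linear_of => a x y; rewrite scaler_sumr -big_split /=.
by apply: eq_bigr => i _; rewrite !mxE scalerDl scalerA.
Qed.

(** * Noetherian modules *)

Definition noetherian_module (V : lmodType R) : Prop :=
  forall S : submodClosed V, finitely_generated S.

Lemma noetherian_extension (A B C : lmodType R)
    (i : {linear A -> B}) (p : {linear B -> C}) :
    (forall y, p y = 0 -> exists x, i x = y) ->
  noetherian_module A -> noetherian_module C -> noetherian_module B.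
Proof.
move=> exact_ip noethA noethC S.
have [|a x y ix iy|SA SAE] := @submod_of_prop A (fun x => i x \in S).
- by rewrite linear0 rpred0.
- by rewrite linearP rpredD ?rpredZ.
have [|a _ _ [x Sx <-] [y Sy <-]|SC SCE] :=
  @submod_of_prop C (fun z => exists2 y, y \in S & p y = z).
- by exists 0; rewrite ?rpred0 ?linear0.
- by exists (a *: x + y); rewrite ?linearP ?rpredD ?rpredZ.
have [n [eA eAE]] := noethA SA; have [m [eC eCE]] := noethC SC.
have eA_S j : i (eA j) \in S.
  exact/SAE/(generator_in eAE).
have /choice[y yE] j : exists y, y \in S /\ p y = eC j.
  have /SCE[y Sy py] : eC j \in SC; last by exists y.
  exact: generator_in eCE j.
exists (n + m)%N, (fun k => match split k with inl j => i (eA j) | inr j => y j end) => x.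
split=> [Sx|[c ->]]; last first.
  by apply: rpred_sum => k _; apply: rpredZ; case: split => j //; case: (yE j).
have /eCE[c cE] : p x \in SC by apply/SCE; exists x.
have [|z zE] := exact_ip (x - \sum_j c j *: y j).
  rewrite linearB linear_sum cE /= -sumrB big1 // => j _.
  by rewrite linearZZ (yE j).2 subrr.
have /eAE[b bE] : z \in SA.
  apply/SAE; rewrite zE submodB //; apply: rpred_sum => j _.
  by rewrite rpredZ // (yE j).1.
exists (fun k => match split k with inl j => b j | inr j => c j end).
rewrite big_split_ord /= -[LHS](subrK (\sum_j c j *: y j)) -zE bE linear_sum.
congr (_ + _); apply: eq_bigr => j _.
  by rewrite linearZZ -[lshift _ _]/(unsplit (inl j)) unsplitK.
by rewrite -[rshift _ _]/(unsplit (inr j)) unsplitK.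
Qed.

Hypothesis noethR : noetherian R.

Lemma noetherian_row n : noetherian_module 'rV[R]_n.
Proof.
elim: n => [|n IHn].
  move=> S; exists 0%N, (fun=> 0) => x; split=> [_|_]; last by rewrite thinmx0 rpred0.
  by exists (fun=> 0); rewrite big_ord0 thinmx0.
have [i iE] : exists i : {linear 'rV[R]_n -> 'rV[R]_n.+1},
    i =1 (fun x => row_mx (0 : 'rV_1) x).
  apply: linear_of => a x y.
  by rewrite (scale_row_mx (n1 := 1)) (add_row_mx (n1 := 1)) scaler0 addr0.
have [p pE] : exists p : {linear 'rV[R]_n.+1 -> R^o}, p =1 (fun x => x 0 0).
  by apply: linear_of => a x y; rewrite !mxE.
apply: (noetherian_extension _ IHn noethR (i := i) (p := p)) => x.
rewrite pE => x0; exists (rsubmx (x : 'rV_(1 + n))).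
apply/rowP => j; rewrite iE mxE; case: splitP => k jk; rewrite !mxE.
  by rewrite -[LHS]x0; congr (x _ _); apply: val_inj; rewrite /= jk ord1.
by congr (x _ _); apply: val_inj; rewrite /= jk.
Qed.

Lemma fg_noetherian (V : lmodType R) : fg_module V -> noetherian_module V.
Proof.
move=> [n [e eE]]; have [h hE] := row_comb_linear e.
(* With zero as third module, exactness says that [h] maps the free module onto [V]. *)
apply: (noetherian_extension (i := h) (p := \0 : {linear V -> 'rV[R]_0}));
  [|exact: noetherian_row..].
move=> y _; have /eE[c ->] : y \in full_submod V by [].
by exists (\row_j c j); rewrite hE; apply: eq_bigr => j _; rewrite mxE.
Qed.

Lemma fg_submodule (V : lmodType R) (S : submodClosed V) :
  finitely_generated S -> fg_module (submodule S).
Proof.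
move=> [n [e eE]].
have eS := generator_in eE.
exists n, (fun j => Submodule (eS j)) => x; split=> // _.
have /eE[c cE] := valP x; exists c; apply: val_inj; rewrite cE.
by rewrite (big_morph val (id1 := 0) (op1 := +%R)).
Qed.


(** * Powers of an ideal acting on a module *)

Lemma mul_submod_scale (I : submodClosed R^o) (V : lmodType R) (S : submodClosed V) a x :
  a \in I -> x \in S -> a *: x \in mul_submod I S.
Proof.
by move=> Ia Sx; apply/asboolP; exists [:: (a, x)]; rewrite /= Ia Sx big_seq1.
Qed.

Lemma mul_submod_ind (I : submodClosed R^o) (V : lmodType R) (S : submodClosed V)
    (P : V -> Prop) :
    P 0 -> (forall x y, P x -> P y -> P (x + y)) ->
    (forall a x, a \in I -> x \in S -> P (a *: x)) ->
  forall x, x \in mul_submod I S -> P x.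
Proof.
move=> P0 PD PZ x /asboolP[s [/allP sP ->]]; rewrite big_seq.
by apply: big_ind => // p /sP/andP[]; apply: PZ.
Qed.

Variable I : submodClosed R^o.

Lemma ideal_expX a k : a \in I -> a ^+ k \in ideal_exp I k.
Proof.
by move=> Ia; elim: k => [//|k IHk]; rewrite exprS; apply: mul_submod_scale.
Qed.

Lemma ideal_expD k n :
  {subset ideal_exp I (k + n) <= mul_submod (ideal_exp I k) (ideal_exp I n)}.
Proof.
elim: k => [|k IHk] x.
  move=> Inx; rewrite -[x](scale1r (x : R^o)).
  exact: (@mul_submod_scale _ _ (ideal_exp I n) 1 x).
move: x; refine (mul_submod_ind _ _ _) => [|y z|a y Ia /IHk]; rewrite ?rpred0 //.
  exact: rpredD.
move: y; refine (mul_submod_ind _ _ _) => [|z t|b z Ib Iz].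
- by rewrite scaler0 rpred0.
- by rewrite scalerDr; apply: rpredD.
rewrite scalerA; apply: mul_submod_scale => //.
exact: mul_submod_scale.
Qed.

(** Lifts will be found on [I^k L] with [L = I^n M], whereas the direct system consists of maps on
    the submodules [I^(k+n) M]; this passes from one to the other. *)
Lemma exp_submodD (V : lmodType R) k n x : x \in exp_submod I V (k + n) ->
  exists2 y : submodule (exp_submod I V n),
    y \in exp_submod I (submodule (exp_submod I V n)) k & val y = x.
Proof.
move: x; refine (mul_submod_ind _ _ _) => [|_ _ [x Ix <-] [y Iy <-]|a x /ideal_expD Ia _].
- by exists 0; rewrite ?rpred0.
- by exists (x + y); rewrite ?rpredD.
move: a Ia; refine (mul_submod_ind _ _ _) => [|a b [y Iy yE] [z Iz zE]|a b Ia Ib].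
- by exists 0; rewrite ?rpred0 ?scale0r.
- by exists (y + z); rewrite ?rpredD // scalerDl -yE -zE.
have bx : b *: x \in exp_submod I V n by apply: mul_submod_scale.
pose y : submodule (exp_submod I V n) := Submodule bx.
by exists ((a : R) *: y); [apply: mul_submod_scale | rewrite /= scalerA].
Qed.

(** A product of [T] generators contains some [e i] at least [m i] times. The induction moves one
    factor [e j] onto [y] and lowers [m j] by one; if [m j = 0], then [y] lies in [W] already. *)
Lemma ideal_exp_pigeonhole (V : lmodType R) (W : submodClosed V) n (e : 'I_n -> R)
    (Ie : forall a, a \in I -> exists c : 'I_n -> R, a = \sum_i c i * e i)
    T (m : 'I_n -> nat) y :
    (\sum_i m i < T)%N -> (forall i, e i ^+ m i *: y \in W) ->
  forall b, b \in ideal_exp I T -> b *: y \in W.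
Proof.
elim: T m y => [//|T IHT] m y mT ey; apply: mul_submod_ind => [|a b|a b /Ie[c ->] Ib].
- by rewrite scale0r rpred0.
- by rewrite scalerDl; apply: rpredD.
rewrite -[_ *: b]/(_ * b) mulr_suml scaler_suml; apply: rpred_sum => j _.
rewrite -mulrA [e j * b]mulrC -!scalerA; apply: rpredZ.
case mj: (m j) (ey j) => [|k]; first by rewrite expr0 scale1r => Wy; rewrite !rpredZ.
rewrite exprSr -scalerA => Wj.
apply: (IHT (fun i => if i == j then k else m i)) Ib => [|i].
  move: mT; rewrite (bigD1 j) //= [in X in _ -> X](bigD1 j) //= eqxx mj addSn ltnS.
  by rewrite [X in _ -> (_ + X < _)%N](eq_bigr m) // => i /negPf->.
case: eqP => [->//|_]; rewrite scalerA mulrC -scalerA; exact: rpredZ.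
Qed.

(** * A weak form of the Artin-Rees lemma *)

Section ArtinRees.
Variables (V : lmodType R) (noethV : noetherian_module V).
Implicit Types K W : submodClosed V.

(** The submodules [(W : a^j)] form an ascending chain with union [U]; exponents for finitely many
    generators of [U] add up to a common bound. *)
Lemma colon_stable W a :
  exists m, forall j y, a ^+ j *: y \in W -> a ^+ m *: y \in W.
Proof.
have [|b x y [j Wx] [k Wy]|U UE] :=
    @submod_of_prop V (fun x => exists j, a ^+ j *: x \in W).
- by exists 0%N; rewrite scaler0 rpred0.
- exists (j + k)%N; rewrite scalerDr rpredD //.
    by rewrite scalerA mulrC addnC exprD -!scalerA; do 2!apply: rpredZ.
  by rewrite exprD -scalerA rpredZ.
have [n [u uE]] := noethV U.
have /choice[k kE] i : exists j, a ^+ j *: u i \in W.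
  exact/UE/(generator_in uE).
exists (\sum_i k i)%N => j y Wy.
have /uE[c ->] : y \in U by apply/UE; exists j.
rewrite scaler_sumr; apply: rpred_sum => i _; rewrite scalerA mulrC -scalerA rpredZ //.
by rewrite (bigD1 i) //= addnC exprD -scalerA rpredZ.
Qed.

(* W' = W + a^m V with m stationary for the chain (W : a^j): if w + a^m y lies in
   K, then a^(c + m) y lies in W, hence so does a^m y. *)
Lemma separate_power K W a c : (forall x, x \in K -> a ^+ c *: x \in W) ->
  exists W' : submodClosed V, [/\ {subset W <= W'},
    forall x, x \in K -> x \in W' -> x \in W & exists m, forall y, a ^+ m *: y \in W'].
Proof.
move=> aK; have [m mE] := colon_stable W a.
have [|b _ _ [w [y [Ww ->]]] [v [z [Wv ->]]]|W' W'E] := @submod_of_prop V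
    (fun x => exists w y, w \in W /\ x = w + a ^+ m *: y).
- by exists 0, 0; rewrite rpred0 scaler0 addr0.
- exists (b *: w + v), (b *: y + z); rewrite rpredD ?rpredZ //; split=> //.
  by rewrite !scalerDr !scalerA [b * _]mulrC addrACA.
exists W'; split=> [w Ww|x Kx|].
- by apply/W'E; exists w, 0; rewrite scaler0 addr0.
- move=> /W'E[w [y [Ww xE]]]; rewrite xE rpredD //.
  apply: (mE (c + m)%N); rewrite exprD -scalerA -[_ *: y](addKr w) -xE addrC.
  by rewrite scalerBr; apply: submodB; [apply: aK | apply: rpredZ].
- by exists m => y; apply/W'E; exists 0, y; rewrite rpred0 add0r.
Qed.

(** Enlarging [W] for one element keeps [a^c K] inside it for the others, and its trace on [K] stays
    in the original [W], so the elements of [s] can be treated one after another. *)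
Lemma separate_powers K W (s : seq R) c :
    (forall a, a \in s -> forall x, x \in K -> a ^+ c *: x \in W) ->
  exists W' : submodClosed V, [/\ {subset W <= W'},
    forall x, x \in K -> x \in W' -> x \in W &
    forall a, a \in s -> exists m, forall y, a ^+ m *: y \in W'].
Proof.
elim: s => [_|a s IHs sK]; first by exists W; split.
have [b bs|W1 [WW1 W1K W1s]] := IHs; first by apply: sK; rewrite inE bs orbT.
have [x Kx|W2 [W12 W2K W2a]] := @separate_power K W1 a c.
  by apply/WW1/sK; rewrite ?mem_head.
exists W2; split=> [x /WW1/W12//|x Kx /(W2K _ Kx)/(W1K _ Kx)//|b].
rewrite inE => /orP[/eqP->//|/W1s[m bm]].
by exists m => y; apply/W12.
Qed.

(* W' separates I^c K from a power of each generator of I, and contains I^k V for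
   large k by the pigeonhole principle; this avoids Rees algebras. *)
Lemma weak_artin_rees K c : exists k, forall x, x \in K -> x \in exp_submod I V k ->
  exists2 y : submodule K, y \in exp_submod I (submodule K) c & val y = x.
Proof.
have [|a _ _ [x Ix <-] [y Iy <-]|W WE] := @submod_of_prop V
    (fun x => exists2 y : submodule K, y \in exp_submod I (submodule K) c & val y = x).
- by exists 0; rewrite ?rpred0.
- by exists (a *: x + y); rewrite ?rpredD ?rpredZ.
have [n [e eE]] := noethR I.
have Ie := generator_in eE.
have [a|W' [_ W'K W'e]] := @separate_powers K W (codom e) c.
  move=> /codomP[i ->] x Kx; apply/WE; pose y : submodule K := Submodule Kx.
  exists ((e i : R) ^+ c *: y) => //; by apply: mul_submod_scale => //; apply: ideal_expX.
have /choice[m mE] i : exists m, forall y, e i ^+ m *: y \in W'.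
  by apply: W'e; apply: codom_f.
exists (\sum_i m i).+1 => x Kx Ix; apply/WE; apply: W'K => //; move: x {Kx} Ix.
refine (mul_submod_ind _ _ _) => [|x y|a x Ia _]; rewrite ?rpred0 //; first exact: rpredD.
apply: (ideal_exp_pigeonhole (e := e)) (mE ^~ x) a Ia => // b.
by move=> /eE[d dE]; exists d.
Qed.

End ArtinRees.

(** * Lifting along a map after restriction to [I^k L] *)

Definition factors_near_zero (A B : lmodType R) (d : {linear A -> B}) : Prop :=
  forall (L : lmodType R) (f : {linear L -> B}), fg_module L ->
    (forall x, exists y, d y = f x) ->
  exists k (g : {linear submodule (exp_submod I L k) -> A}),
    forall x, d (g x) = f (val x).

(* Only the part of h on K is lifted, so that d = res_aug, whose source N is not
   injective, satisfies this with u = 0. *)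
Definition extends_near_zero (A B : lmodType R) (d : {linear A -> B}) : Prop :=
  forall (F : lmodType R) (K : submodClosed F) (h : {linear F -> B}),
    noetherian_module F -> (forall x, x \in K -> exists y, d y = h x) ->
  exists k (u : {linear submodule (exp_submod I F k) -> A}),
    forall x, val x \in K -> d (u x) = h (val x).

(** The image of each generator of [L] comes from [N], so a power of [I] kills it; the sum of the
    exponents serves for all generators. *)
Lemma torsion_image_killed (N B L : lmodType R) (d : {linear N -> B})
    (f : {linear L -> B}) :
    torsion_module I N -> fg_module L -> (forall x, exists y, d y = f x) ->
  exists k, forall x, x \in exp_submod I L k -> f x = 0.
Proof.
move=> torsN [n [e eE]] df; have /choice[y yE] i := df (e i).
have /choice[k kE] i : exists k, forall a, a \in ideal_exp I k -> a *: y i = 0.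
  by have [k _ ky] := torsN (y i); exists k.
exists (\sum_i k i)%N; refine (mul_submod_ind _ _ _) => [|x z fx fz|a x Ia _].
- exact: linear0.
- by rewrite linearD fx fz addr0.
have /eE[c ->] : x \in full_submod L by [].
rewrite linearZZ linear_sum scaler_sumr big1 // => i _.
rewrite linearZZ -yE scalerA mulrC -scalerA -(linearZZ d a) kE ?linear0 ?scaler0 //.
by apply: ideal_exp_le Ia; rewrite (bigD1 i) //= leq_addr.
Qed.

(** By Artin-Rees, [I^k F] meets [K] inside some [I^c K] on which [h] vanishes by torsion, so
    [u = 0] is enough. *)
Lemma torsion_extends_near_zero (N B : lmodType R) (d : {linear N -> B}) :
  torsion_module I N -> extends_near_zero d.
Proof.
move=> torsN F K h noethF hK.
have [f fE] := @linear_of (submodule K) B (fun x => h (val x))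
  (fun a x y => linearP h a _ _).
have [||c cE] := @torsion_image_killed _ _ (submodule K) d f torsN.
- exact/fg_submodule/noethF.
- by move=> x; rewrite fE; apply: hK (valP x).
have [k kE] := weak_artin_rees noethF K c.
exists k, \0 => x Kx; have [y Iy yx] := kE _ Kx (valP x).
by rewrite linear0 -yx -fE cE.
Qed.

Lemma factors_of_extends (A B C : lmodType R)
    (d : {linear A -> B}) (d' : {linear B -> C}) :
    (forall x, d' x = 0 <-> exists y, d y = x) ->
  extends_near_zero d -> factors_near_zero d'.
Proof.
move=> exact_d extd L f [n [e eE]] d'f; have /choice[y yE] i := d'f (e i).
have [p pE] := row_comb_linear e; have [h hE] := row_comb_linear y.
have d'h x : d' (h x) = f (p x).
  by rewrite hE pE !linear_sum; apply: eq_bigr => i _; rewrite !linearZZ yE.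
have [K KE] := kernel_submod p.
have [x|k [u uE]] := extd _ K h (@noetherian_row n).
  by move=> /KE px; apply/exact_d; rewrite d'h px linear0.
(* [p] restricts to a surjection [q] from [I^k] of the free cover onto [I^k L]. *)
have pI x : x \in exp_submod I 'rV[R]_n k -> p x \in exp_submod I L k.
  move: x; refine (mul_submod_ind _ _ _) => [|x z|a x Ia _].
  - by rewrite linear0 rpred0.
  - by rewrite linearD; apply: rpredD.
  - by rewrite linearZZ; apply: mul_submod_scale.
have pI_surj y0 : y0 \in exp_submod I L k ->
    exists2 x, x \in exp_submod I 'rV[R]_n k & p x = y0.
  move: y0; refine (mul_submod_ind _ _ _) => [|_ _ [x Ix <-] [z Iz <-]|a z Ia _].
  - by exists 0; rewrite ?rpred0 ?linear0.
  - by exists (x + z); rewrite ?rpredD ?linearD.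
  have /eE[c ->] : z \in full_submod L by [].
  exists (a *: \row_i c i); first exact: mul_submod_scale.
  by rewrite linearZZ pE; congr (_ *: _); apply: eq_bigr => i _; rewrite mxE.
have [q qE] : exists q : {linear submodule (exp_submod I 'rV[R]_n k) ->
    submodule (exp_submod I L k)}, forall x, val (q x) = p (val x).
  have [|q qE] := @linear_of (submodule (exp_submod I 'rV[R]_n k))
    (submodule (exp_submod I L k))
    (fun x : submodule (exp_submod I 'rV[R]_n k) => Submodule (pI _ (valP x))).
    by move=> a x z; apply: val_inj; rewrite /= linearP.
  by exists q => x; rewrite qE.
(* The correction [d (u x)] makes [v] vanish on the kernel of [q], and [d'] does not see it because
   [d' \o d = 0]. *)
have [v vE] : exists v : {linear submodule (exp_submod I 'rV[R]_n k) -> B},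
    forall x, v x = h (val x) - d (u x).
  apply: linear_of => a x z.
  by rewrite /= !linearP scalerBr /= scalerN addrACA.
have [||g gE] := @surj_factor _ _ _ q v.
- move=> z; have [x Ix px] := pI_surj _ (valP z).
  by exists (Submodule Ix); apply: val_inj; rewrite qE.
- move=> x qx; rewrite vE uE ?subrr //; apply/KE.
  by rewrite -qE qx.
exists k, g => z; have [x Ix px] := pI_surj _ (valP z).
have -> : z = q (Submodule Ix) by apply: val_inj; rewrite qE.
rewrite gE vE linearB d'h qE /=.
by rewrite (_ : d' (d _) = 0) ?subr0 //; apply/exact_d; eexists.
Qed.

Lemma extends_of_factors (A B : lmodType R) (d : {linear A -> B}) :
  injective_module A -> factors_near_zero d -> extends_near_zero d.
Proof.
move=> injA facd F K h noethF hK.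
have [f fE] := @linear_of (submodule K) B (fun x => h (val x))
  (fun a x y => linearP h a _ _).
have [||c [g gE]] := facd (submodule K) f.
- exact/fg_submodule/noethF.
- by move=> x; rewrite fE; apply: hK (valP x).
have [k kE] := weak_artin_rees noethF K c.
(* [S] is [I^k F] intersected with [K], formed inside [I^k F] so that [injA] can extend a map from
   it. *)
have [|a x y Kx Ky|S SE] :=
    @submod_of_prop (submodule (exp_submod I F k)) (fun x => val x \in K).
- exact: rpred0.
- by rewrite /= rpredD ?rpredZ.
(* Artin-Rees places each element of [S] in [I^c K]. An element there is determined by its value in
   [F], so [g \o s] is linear although [s] is merely chosen. *)
have /choice[s sE] (x : submodule S) :
    exists y : submodule (exp_submod I (submodule K) c),
    val (val y) = val (val x).
  have [|y Iy yx] := kE (val (val x)) _ (valP (val x)); first exact/SE/valP.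
  by exists (Submodule Iy).
have [|g' g'E] := @linear_of (submodule S) A (g \o s).
  move=> a x y; rewrite /= -linearP; congr (g _); apply/val_inj/val_inj.
  by rewrite sE /= !sE.
have [i iE] := linear_of (@submodule_val_is_linear _ S).
have [|u uE] := injA _ _ i g'.
  by move=> x y; rewrite !iE; apply: val_inj.
exists k, u => x /SE Sx.
have -> : x = i (Submodule Sx) by rewrite iE.
by rewrite uE g'E /= gE fE sE iE.
Qed.

End Modules.

(** * The injective resolution and cocycles of the ideal transform *)

Section Resolution.
Variables (R : comNzRingType) (I : submodClosed R^o) (N : lmodType R).
Hypotheses (noethR : noetherian R) (torsN : torsion_module I N).
Variable E : injective_resolution N.

(** [res_d E n] governs degree [n.+1]. For [n = 0] the preceding map is the augmentation, whose
    source [N] is handled by torsion; afterwards the source is injective. *)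
Lemma resolution_factors n : factors_near_zero I (res_d E n).
Proof.
elim: n => [|n IHn].
  apply: (factors_of_extends noethR (@res_exact0 _ _ E)).
  exact: torsion_extends_near_zero.
apply: (factors_of_extends noethR (@res_exact _ _ E n)).
by apply: extends_of_factors => //; apply: res_injective.
Qed.

(** Vanishing in the limit means vanishing at some later stage [k], so restricting a representative
    to stage [k] gives a genuine cocycle. *)
Lemma transform_cocycle_rep (M : lmodType R) i (z : cplx (ideal_transform I M) E i) :
    cplx_d (ideal_transform I M) E i z = 0 ->
  exists n (f : {linear submodule (exp_submod I M n) -> res_obj E i}),
    z = to_dirlim (A := transform_system I M (res_obj E i)) (i := n) f
    /\ forall x, res_d E i (f x) = 0.
Proof.
elim/dirlim_ind: z => n f; rewrite /cplx_d /= /transform_fmap dirlim_mapE.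
move=> dz; have /to_dirlim_eq[k [hk [hk' /= df0]]] :=
  etrans dz (esym (to_dirlim0 _ n)).
exists k, (ds_map (transform_system I M (res_obj E i)) hk f); split.
  exact/esym/(to_dirlim_map (A := transform_system I M (res_obj E i)) hk f).
by move=> x; have := congr1 (fun g : Defs.hom _ _ => g x) df0; rewrite linear0.
Qed.

End Resolution.

Theorem theorem2p1 (R : comNzRingType) (I : submodClosed R^o) (M N : lmodType R)
  (noethR : noetherian R) (fgM : fg_module M) (torsN : torsion_module I N)
  (E : injective_resolution N) (i : nat) :
  forall x : right_derived (ideal_transform I M) E i, x = 0.
Proof.
elim/quot_ind=> -[z /= zc]; apply/to_quot_eq0/asboolP => /=.
move/eqP: zc => /transform_cocycle_rep[n [f [-> df0]]] {z}.
have fgI : fg_module (submodule (exp_submod I M n)).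
  exact/fg_submodule/fg_noetherian.
have hn k : (n <= k + n)%N by apply: leq_addl.
case: i f df0 => [|i] f df0 /=.
  (* In degree 0 the only coboundary is 0. By exactness [f] takes values in the image of [N], so [f]
     itself vanishes on a smaller submodule. *)
  have [|k fk] := @torsion_image_killed _ _ _ _ _ (res_aug E) f torsN fgI.
    by move=> x; apply/res_exact0.
  transitivity (dirlim0 (transform_system I M (res_obj E 0))) => //.
  rewrite -(to_dirlim0 _ 0); apply/to_dirlim_eq.
  exists (k + n)%N, (hn k), (leq0n _); apply: homP => x /=.
  have [y Iy yx] := exp_submodD (valP x).
  by rewrite (_ : incl _ x = y) ?fk //; apply: val_inj.
have [|k [g gE]] := @resolution_factors _ _ _ noethR torsN E i _ f fgI.
  by move=> x; apply/res_exact.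
(* [g] is defined on [I^k (I^n M)]; transported to [I^(k+n) M], it becomes an element of the direct
   system. *)
have /choice[s sE] (x : submodule (exp_submod I M (k + n))) :
    exists y : submodule (exp_submod I (submodule (exp_submod I M n)) k),
    val (val y) = val x.
  by have [y Iy yx] := exp_submodD (valP x); exists (Submodule Iy).
have [|g' g'E] := @linear_of _ (submodule (exp_submod I M (k + n)))
  (res_obj E i) (g \o s).
  move=> a x y; rewrite /= -linearP; congr (g _); apply/val_inj/val_inj.
  by rewrite sE /= !sE.
exists (to_dirlim (A := transform_system I M (res_obj E i)) (i := (k + n)%N) g').
rewrite /cplx_d /= /transform_fmap dirlim_mapE; apply/to_dirlim_eq.
exists (k + n)%N, (leqnn _), (hn k); apply: homP => x /=.
rewrite g'E /= gE; congr (f _); apply: val_inj.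
by rewrite sE.
Qed.
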